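(* Consider the uplink total transmit power minimization problem $$\mathcal{P}1:\quad \min_{\mathbf{f}_{i,u},\,\lambda_{i,u},\ \forall i,u}\ \sum_{i,u}\lambda_{i,u}\quad\text{s.t.}\quad \max_{\mathbf{f}_{i,u}}\Gamma^{\rm ul}_{i,u}\ \ge\ \gamma_{i,u}\quad\forall i,u,$$ where $\Gamma^{\rm ul}_{i,u}$ is the quantized uplink SINR defined in the context and the $\lambda_{i,u}$ are transmit powers. For any initialization $\lambda_{i,u}^{(0)}$, $\forall i,u$, the fixed-point iterative algorithm $$\lambda_{i,u}^{(n+1)}=\frac{1}{\alpha\left(1+\frac{1}{\gamma_{i,u}}\right)\mathbf{h}_{i,i,u}^H\mathbf{K}_i^{-1}(\boldsymbol{\Lambda}^{(n)})\mathbf{h}_{i,i,u}},\qquad\forall i,u,\ n=0,1,2,\dots,$$ $$\mathbf{K}_i(\boldsymbol{\Lambda})=\mathbf{I}_{N_b}+\alpha\sum_{j,v}\lambda_{j,v}\mathbf{h}_{i,j,v}\mathbf{h}_{i,j,v}^H+\beta\,\mathrm{diag}(\mathbf{H}_i\boldsymbol{\Lambda}\mathbf{H}_i^H),$$ converges to a unique fixed point at which the total transmit power is minimized (i.e. the limit is an optimal power allocation for $\mathcal{P}1$).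
   Context: Setting. $N_c,N_u,N_b$ are positive integers (numbers of cells, users per cell, antennas per base station). Indices: $i,j\in\{1,\dots,N_c\}$, $u,v\in\{1,\dots,N_u\}$; $\sum_{i,u}$ is the sum over all such pairs. The channels $\mathbf{h}_{i,j,u}\in\mathbb{C}^{N_b}$ (between base station $i$ and user $u$ of cell $j$) are given, $\mathbf{H}_{i,j}=[\mathbf{h}_{i,j,1},\dots,\mathbf{h}_{i,j,N_u}]$ and $\mathbf{H}_i=[\mathbf{H}_{i,1},\dots,\mathbf{H}_{i,N_c}]\in\mathbb{C}^{N_b\times N_cN_u}$. The quantizer gain is $\alpha\in(0,1]$ and $\beta=1-\alpha$. The target SINRs are $\gamma_{i,u}>0$. For a square matrix $\mathbf{A}$, $\mathrm{diag}(\mathbf{A})$ is the diagonal matrix with the same diagonal entries as $\mathbf{A}$. Uplink. The $\lambda_{i,u}$ (including the initial values $\lambda_{i,u}^{(0)}$) are transmit powers, hence nonnegative reals. Let $\boldsymbol{\Lambda}$ be the $N_cN_u\times N_cN_u$ diagonal matrix with entries $\lambda_{1,1},\dots,\lambda_{1,N_u},\dots,\lambda_{N_c,1},\dots,\lambda_{N_c,N_u}$; $\boldsymbol{\Lambda}^{(n)}$ is the same matrix formed from $\lambda_{i,u}^{(n)}$. The quantization noise covariance is $\mathbf{C}_{\mathbf{q}^{\rm ul}_i\mathbf{q}^{\rm ul}_i}=\alpha\beta\,\mathrm{diag}(\mathbf{H}_i\boldsymbol{\Lambda}\mathbf{H}_i^H+\mathbf{I}_{N_b})$. For a combiner $\mathbf{f}_{i,u}\in\mathbb{C}^{N_b}\setminus\{\mathbf{0}\}$,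 $$\Gamma^{\rm ul}_{i,u}=\frac{\alpha^2\lambda_{i,u}|\mathbf{f}_{i,u}^H\mathbf{h}_{i,i,u}|^2}{\alpha^2\sum_{(j,v)\ne(i,u)}\lambda_{j,v}|\mathbf{f}_{i,u}^H\mathbf{h}_{i,j,v}|^2+\mathbf{f}_{i,u}^H\mathbf{C}_{\mathbf{q}^{\rm ul}_i\mathbf{q}^{\rm ul}_i}\mathbf{f}_{i,u}+\alpha^2\|\mathbf{f}_{i,u}\|^2}.$$
   Formalization: The formal theorem adds that P1 is feasible (some nonnegative powers meet all SINR targets); without it the iteration can diverge, e.g. one cell, user and antenna with h=1, α=1/2, γ=2 gives λ' = (4/3)(1+λ), and no optimal allocation exists. *)

(* Defs.v *)
From mathcomp Require Import all_boot all_order all_algebra.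
From mathcomp Require Import spectral.
From mathcomp Require Import complex.
From mathcomp Require Import all_classical all_reals all_analysis.

Set Implicit Arguments.
Unset Strict Implicit.
Unset Printing Implicit Defensive.

Import Order.TTheory GRing.Theory Num.Theory.
Import numFieldNormedType.Exports.

Local Open Scope ring_scope.
Local Open Scope complex_scope.
Local Open Scope sesquilinear_scope.

Definition diag_part (C : nmodType) (n : nat) (A : 'M[C]_n) : 'M[C]_n :=
  diag_mx (\row_k A k k).

(* [Normc.normc] and [complex.Re] are the modulus and the real part with
   values in [R], unlike the [R[i]]-valued [`|z|] and ['Re z].               *)
Definition sqnorm (R : realType) (n : nat) (f : 'cV[R[i]]_n) : R :=
  \sum_k Normc.normc (f k 0) ^+ 2.

Definition inner (R : realType) (n : nat) (x y : 'cV[R[i]]_n) : R[i] :=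
  (x ^t* *m y) 0 0.

(* Only applied to Hermitian [A], for which x^H A x is a real number; the
   projection [complex.Re] is then a mere cast from [R[i]] to [R].           *)
Definition herm_form (R : realType) (n : nat) (A : 'M[R[i]]_n)
    (x : 'cV[R[i]]_n) : R :=
  complex.Re (inner x (A *m x)).

(* [h i j u] is the channel between base station [i] and user [u] of cell
   [j]. Power allocations are matrices [lam] with [lam i u] the power of user
   [u] of cell [i]. [mxvec] enumerates the pairs (cell, user) in row-major
   order (1,1), ..., (1,Nu), ..., (Nc,1), ..., (Nc,Nu).                      *)

Definition chan_mx (R : realType) (Nc Nu Nb : nat)
    (h : 'I_Nc -> 'I_Nc -> 'I_Nu -> 'cV[R[i]]_Nb) (i : 'I_Nc) :
    'M[R[i]]_(Nb, Nc * Nu) :=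
  \matrix_(k < Nb) mxvec (\matrix_(j < Nc, v < Nu) h i j v k 0).

Definition power_mx (R : realType) (Nc Nu : nat) (lam : 'M[R]_(Nc, Nu)) :
    'M[R[i]]_(Nc * Nu) :=
  diag_mx (mxvec (map_mx (real_complex R) lam)).

Definition rx_cov (R : realType) (Nc Nu Nb : nat)
    (h : 'I_Nc -> 'I_Nc -> 'I_Nu -> 'cV[R[i]]_Nb)
    (lam : 'M[R]_(Nc, Nu)) (i : 'I_Nc) : 'M[R[i]]_Nb :=
  chan_mx h i *m power_mx lam *m (chan_mx h i) ^t*.

Definition quant_cov (R : realType) (Nc Nu Nb : nat) (alpha : R)
    (h : 'I_Nc -> 'I_Nc -> 'I_Nu -> 'cV[R[i]]_Nb)
    (lam : 'M[R]_(Nc, Nu)) (i : 'I_Nc) : 'M[R[i]]_Nb :=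
  (alpha * (1 - alpha))%:C *: diag_part (rx_cov h lam i + 1%:M).

Definition SINR_ul (R : realType) (Nc Nu Nb : nat) (alpha : R)
    (h : 'I_Nc -> 'I_Nc -> 'I_Nu -> 'cV[R[i]]_Nb)
    (lam : 'M[R]_(Nc, Nu)) (i : 'I_Nc) (u : 'I_Nu)
    (f : 'cV[R[i]]_Nb) : R :=
  (alpha ^+ 2 * lam i u * Normc.normc (inner f (h i i u)) ^+ 2)
  / (alpha ^+ 2 * (\sum_(p : 'I_Nc * 'I_Nu | p != (i, u))
        lam p.1 p.2 * Normc.normc (inner f (h i p.1 p.2)) ^+ 2)
     + herm_form (quant_cov alpha h lam i) f
     + alpha ^+ 2 * sqnorm f).

Definition is_max_SINR_ul (R : realType) (Nc Nu Nb : nat) (alpha : R)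
    (h : 'I_Nc -> 'I_Nc -> 'I_Nu -> 'cV[R[i]]_Nb)
    (lam : 'M[R]_(Nc, Nu)) (i : 'I_Nc) (u : 'I_Nu) (m : R) : Prop :=
  (exists2 f : 'cV[R[i]]_Nb, f != 0 & SINR_ul alpha h lam i u f = m) /\
  (forall f : 'cV[R[i]]_Nb, f != 0 -> SINR_ul alpha h lam i u f <= m).

Definition nonneg_power (R : realType) (Nc Nu : nat)
    (lam : 'M[R]_(Nc, Nu)) : Prop :=
  forall i u, 0 <= lam i u.

(* The decision variables are the combiners [f] and the powers [lam]. The
   combiner is maximised over inside each SINR constraint, so [f] itself is
   constrained only to be nonzero.                                           *)
Definition P1_feasible (R : realType) (Nc Nu Nb : nat) (alpha : R)
    (gamma : 'I_Nc -> 'I_Nu -> R)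
    (h : 'I_Nc -> 'I_Nc -> 'I_Nu -> 'cV[R[i]]_Nb)
    (f : 'I_Nc -> 'I_Nu -> 'cV[R[i]]_Nb) (lam : 'M[R]_(Nc, Nu)) : Prop :=
  [/\ forall i u, f i u != 0,
      nonneg_power lam
    & forall i u, exists2 m : R,
        is_max_SINR_ul alpha h lam i u m & gamma i u <= m].

Definition total_power (R : realType) (Nc Nu : nat)
    (lam : 'M[R]_(Nc, Nu)) : R :=
  \sum_i \sum_u lam i u.

Definition P1_optimal (R : realType) (Nc Nu Nb : nat) (alpha : R)
    (gamma : 'I_Nc -> 'I_Nu -> R)
    (h : 'I_Nc -> 'I_Nc -> 'I_Nu -> 'cV[R[i]]_Nb)
    (f : 'I_Nc -> 'I_Nu -> 'cV[R[i]]_Nb) (lam : 'M[R]_(Nc, Nu)) : Prop :=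
  P1_feasible alpha gamma h f lam /\
  forall f' lam', P1_feasible alpha gamma h f' lam' ->
    total_power lam <= total_power lam'.

Definition K_mx (R : realType) (Nc Nu Nb : nat) (alpha : R)
    (h : 'I_Nc -> 'I_Nc -> 'I_Nu -> 'cV[R[i]]_Nb)
    (lam : 'M[R]_(Nc, Nu)) (i : 'I_Nc) : 'M[R[i]]_Nb :=
  1%:M
  + alpha%:C *: (\sum_j \sum_v
        (lam j v)%:C *: (h i j v *m (h i j v) ^t*))
  + (1 - alpha)%:C *: diag_part (rx_cov h lam i).

Definition power_step (R : realType) (Nc Nu Nb : nat) (alpha : R)
    (gamma : 'I_Nc -> 'I_Nu -> R)
    (h : 'I_Nc -> 'I_Nc -> 'I_Nu -> 'cV[R[i]]_Nb)
    (lam : 'M[R]_(Nc, Nu)) : 'M[R]_(Nc, Nu) :=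
  \matrix_(i < Nc, u < Nu)
    (1 / (alpha * (1 + 1 / gamma i u)
          * herm_form (invmx (K_mx alpha h lam i)) (h i i u))).

(* Main.v *)
Require Import Defs.
From mathcomp Require Import all_boot all_order all_algebra.
From mathcomp Require Import spectral complex ring lra.
From mathcomp Require Import all_classical all_reals all_analysis.

Import Order.TTheory GRing.Theory Num.Theory.
Import numFieldNormedType.Exports.

Local Open Scope complex_scope.
Local Open Scope sesquilinear_scope.
Local Open Scope ring_scope.
Local Open Scope classical_set_scope.


(* Combiners are scored by the Rayleigh-type quotient [|f^H h|^2 / (f^H K f)],
   where [f^H K_i(lam) f = |f|^2 + \sum_p lam_p c_p(f)] is affine in [lam] with
   coefficients [c_p(f) >= 0]. By Cauchy-Schwarz for [K] the supremum of this
   quotient is [s = h^H K^-1 h], attained at [f = K^-1 h]; since the SINR equals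
   [alpha lam |f^H h|^2 / (f^H K f - alpha lam |f^H h|^2)], the constraint
   [max SINR >= gamma] at user [(i, u)] is exactly [lam_iu >= T(lam)_iu], with
   [T] the iteration map. Being a minimum of such affine functions, [T] is a
   standard interference function in the sense of Yates: positive, monotone
   and strictly subhomogeneous. Hence orbits started at feasible points
   decrease, limits of orbits are fixed points, the fixed point is unique, and
   it lies below every feasible allocation; any other orbit is squeezed between
   those started at [0] and at a large multiple of the fixed point.           *)

(** * Fixed points and orbits of a standard interference function *)

Section Yates.
Context {R : realType} {m n : nat}.
Implicit Types (x y l : 'M[R]_(m, n)) (a : R).

Definition lemx x y := forall i j, x i j <= y i j.

Variable T : 'M[R]_(m, n) -> 'M[R]_(m, n).
Hypothesis T_gt0 : forall x, nonneg_power x -> forall i j, 0 < T x i j.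
Hypothesis T_mono : forall x y, nonneg_power x -> lemx x y -> lemx (T x) (T y).
Hypothesis T_scale : forall a x, 1 < a -> nonneg_power x ->
  forall i j, T (a *: x) i j < a * T x i j.

Lemma nonneg_lemx x y : nonneg_power x -> lemx x y -> nonneg_power y.
Proof. by move=> x0 xy i j; apply: le_trans (xy i j). Qed.

Lemma nonneg_scale a x : 0 <= a -> nonneg_power x -> nonneg_power (a *: x).
Proof. by move=> a0 x0 i j; rewrite mxE mulr_ge0. Qed.

Lemma nonneg_iter k x : nonneg_power x -> nonneg_power (iter k T x).
Proof.
by case: k => [//|k] x0; elim: k => [|k IH] i j; apply/ltW/T_gt0.
Qed.

Lemma iter_lemx k x y : nonneg_power x -> lemx x y ->
  lemx (iter k T x) (iter k T y).
Proof.
by move=> x0 xy; elim: k => [//|k IH] /=; apply: T_mono => //; apply: nonneg_iter.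
Qed.

(* Continuity of [T] is not needed: eventually the orbit lies between [l / a]
   and [a l], so monotonicity and scaling trap [T l] between [l / a] and [a l]
   for every [a > 1].                                                         *)
Lemma cvg_orbit_fixed x l : nonneg_power x ->
  (forall i j, iter k T x i j @[k --> \oo] --> l i j) ->
  (forall i j, 0 < l i j) -> T l = l.
Proof.
move=> x0 xl l0.
have l0' : nonneg_power l by move=> i j; apply/ltW.
have near_l a : 1 < a -> \forall k \near \oo,
    lemx (a^-1 *: l) (iter k T x) /\ lemx (iter k T x) (a *: l).
  move=> a1; have a0 : 0 < a by apply: lt_trans a1.
  have nij i j : \forall k \near \oo,
      (a^-1 *: l) i j <= iter k T x i j <= (a *: l) i j.
    near=> k; rewrite !mxE; apply/andP; split; near: k.
      apply: (cvgr_ge (l i j)) => //.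
      by rewrite ltr_pdivrMl // ltr_pMl.
    apply: (cvgr_le (l i j)) => //.
    by rewrite ltr_pMl.
  have : \forall k \near \oo, forall i j,
      (a^-1 *: l) i j <= iter k T x i j <= (a *: l) i j.
    apply: filter_forall => i; apply: filter_forall => j; exact: nij.
  by apply: filterS => k H; split=> i j; have /andP[] := H i j.
have sandwich a i j : 1 < a -> a^-1 * T l i j <= l i j <= a * T l i j.
  move=> a1; have a0 : 0 < a by apply: lt_trans a1.
  have xl' : iter k.+1 T x i j @[k --> \oo] --> l i j.
    by rewrite (cvg_shiftS (fun k => iter k T x i j)); exact: xl.
  have le1 : \forall k \near \oo,
      a^-1 * T l i j <= iter k.+1 T x i j <= a * T l i j.
    apply: filterS (near_l a a1) => k [lo hi]; apply/andP; split.
      have al0 : nonneg_power (a^-1 *: l) by apply: nonneg_scale; rewrite ?invr_ge0 ?ltW.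
      apply: le_trans (T_mono _ _ al0 lo i j).
      rewrite ler_pdivrMl // -{1}[l](@scalerK _ _ a) ?gt_eqF //.
      by rewrite scalerA mulrC -scalerA; apply/ltW/T_scale.
    apply: le_trans (T_mono _ _ (nonneg_iter k _ x0) hi i j) _.
    exact/ltW/T_scale.
  rewrite -(cvg_lim _ xl') //; apply/andP; split.
    apply: limr_ge; first by apply/cvg_ex; exists (l i j).
    by apply: filterS le1 => k /andP[].
  apply: limr_le; first by apply/cvg_ex; exists (l i j).
  by apply: filterS le1 => k /andP[].
apply/matrixP => i j; apply/eqP; rewrite eq_le; apply/andP; split.
  apply/ler_addgt0Pr => e e0.
  (* This factor makes [a * l i j] equal to [l i j + e]; the converse inequality uses [T l i j] in
     the same way. *)
  have := sandwich (1 + e / l i j) i j; rewrite ltrDl divr_gt0 // => /(_ isT).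
  have p0 : 0 < 1 + e / l i j by rewrite addr_gt0 ?divr_gt0.
  rewrite ler_pdivrMl // => /andP[+ _]; rewrite mulrDl mul1r divfK // gt_eqF //.
apply/ler_addgt0Pr => e e0.
have Tl0 : 0 < T l i j by apply: T_gt0.
have := sandwich (1 + e / T l i j) i j; rewrite ltrDl divr_gt0 // => /(_ isT) /andP[_].
by rewrite mulrDl mul1r divfK // gt_eqF.
Unshelve. all: by end_near. Qed.

(** Let [r] be the largest ratio [x / y], attained at [(i, j)]. Then [x <= r y], and if [r > 1],
    monotonicity and strict scaling give [x i j = T x i j <= T (r y) i j < r * y i j = x i j], a
    contradiction. *)
Lemma fixed_le x y : nonneg_power x -> nonneg_power y ->
  T x = x -> T y = y -> lemx x y.
Proof.
move=> x0 y0 Tx Ty i0 j0.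
have yp i j : 0 < y i j by rewrite -Ty; apply: T_gt0.
pose r (p : 'I_m * 'I_n) := x p.1 p.2 / y p.1 p.2.
have [[i j] _ rmax] := @arg_maxP _ R _ (i0, j0) xpredT r isT.
have xay : lemx x (r (i, j) *: y).
  by move=> k l; rewrite mxE -ler_pdivrMr //; apply: (rmax (k, l)).
case: (leP (r (i, j)) 1) => [r1|r1].
  by apply: le_trans (xay i0 j0) _; rewrite mxE ler_piMl.
have lt_ij := T_scale _ _ r1 y0 i j.
rewrite Ty {2}/r /= divfK ?gt_eqF // in lt_ij.
by have := T_mono _ _ x0 xay i j; rewrite Tx leNgt lt_ij.
Qed.

Lemma fixed_unique x y : nonneg_power x -> nonneg_power y ->
  T x = x -> T y = y -> x = y.
Proof.
move=> x0 y0 Tx Ty; apply/matrixP => i j.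
by apply/eqP; rewrite eq_le !fixed_le.
Qed.

(** Monotonicity propagates [T x <= x] along the orbit, which decreases and is bounded below by 0.
    Its limit is positive because every later iterate stays above [T 0 > 0]. *)
Lemma descending_orbit x : nonneg_power x -> lemx (T x) x ->
  exists l, [/\ forall i j, iter k T x i j @[k --> \oo] --> l i j,
    lemx l x, forall i j, 0 < l i j & T l = l].
Proof.
move=> x0 Txx.
have dec i j : nonincreasing_seq (fun k => iter k T x i j).
  apply/nonincreasing_seqP => k; rewrite iterSr.
  by apply: iter_lemx => // i' j'; apply/ltW/T_gt0.
pose z := T 0.
have z0 : nonneg_power (0 : 'M[R]_(m, n)) by move=> i j; rewrite mxE.
have lb i j k : z i j <= iter k.+1 T x i j.
  by rewrite iterS; apply: T_mono => // i' j'; rewrite mxE; apply: nonneg_iter.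
have cv i j : cvgn (fun k => iter k T x i j).
  apply: nonincreasing_is_cvgn => //; exists 0 => _ [k _ <-].
  exact: nonneg_iter.
pose l : 'M[R]_(m, n) := \matrix_(i, j) limn (fun k => iter k T x i j).
have xl i j : iter k T x i j @[k --> \oo] --> l i j by rewrite mxE; apply: cv.
have lp i j : 0 < l i j.
  apply: (@lt_le_trans _ _ (z i j)); first exact: T_gt0.
  rewrite mxE; apply: limr_ge => //.
  by exists 1%N => // -[|k] //= _; apply: lb.
exists l; split => //; last exact: cvg_orbit_fixed xl lp.
by move=> i j; rewrite mxE; apply: limr_le => //; apply: nearW => k; apply: (dec i j 0%N).
Qed.

(** A fixed point [y] is its own orbit and so dominates the increasing orbit of 0; the limit of that
    orbit is a fixed point, hence [y] by uniqueness. *)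
Lemma ascending_orbit y : nonneg_power y -> T y = y ->
  forall i j, iter k T 0 i j @[k --> \oo] --> y i j.
Proof.
move=> y0 Ty.
have z0 : nonneg_power (0 : 'M[R]_(m, n)) by move=> i j; rewrite mxE.
have z_le x : nonneg_power x -> lemx 0 x by move=> x0 i j; rewrite mxE.
have inc i j : nondecreasing_seq (fun k => iter k T 0 i j).
  apply/nondecreasing_seqP => k; rewrite iterSr.
  by apply: iter_lemx => //; apply: z_le => i' j'; apply/ltW/T_gt0.
have ub i j k : iter k T 0 i j <= y i j.
  have -> : y = iter k T y by elim: k => [//|k IH]; rewrite iterS -IH Ty.
  by apply: iter_lemx => //; apply: z_le.
have cv i j : cvgn (fun k => iter k T 0 i j).
  by apply: nondecreasing_is_cvgn => //; exists (y i j) => _ [k _ <-].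
pose l : 'M[R]_(m, n) := \matrix_(i, j) limn (fun k => iter k T 0 i j).
have xl i j : iter k T 0 i j @[k --> \oo] --> l i j by rewrite mxE; apply: cv.
have lp i j : 0 < l i j.
  apply: (@lt_le_trans _ _ (T 0 i j)); first exact: T_gt0.
  rewrite mxE; apply: limr_ge => //.
  (* The bound by [T 0] starts at index 1, since the iterate of index 0 is 0. *)
  by exists 1%N => // -[|k] //= _; apply: (inc i j 1%N k.+1).
suff <- : l = y by [].
by apply: fixed_unique => //; [move=> i j; apply/ltW | apply: cvg_orbit_fixed xl lp].
Qed.

Lemma cvg_iter_fixed x y : nonneg_power x -> nonneg_power y -> T y = y ->
  forall i j, iter k T x i j @[k --> \oo] --> y i j.
Proof.
move=> x0 y0 Ty i j.
have yp i' j' : 0 < y i' j' by rewrite -Ty; apply: T_gt0.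
(* This [a] exceeds 1 and every ratio [x i j / y i j], so that [x <= a y] and [T (a y) <= a y]. *)
pose a := 2 + \sum_i \sum_j x i j / y i j.
have q0 k k' : 0 <= x k k' / y k k' by rewrite divr_ge0.
have S0 : 0 <= \sum_i \sum_j x i j / y i j.
  by apply: sumr_ge0 => k _; apply: sumr_ge0.
have a1 : 1 < a by rewrite /a; lra.
have a0 : 0 <= a by rewrite ltW // (lt_trans _ a1).
have xay : lemx x (a *: y).
  move=> k k'; rewrite mxE -ler_pdivrMr // /a (bigD1 k) //= (bigD1 k') //=.
  have s1 : 0 <= \sum_(j | j != k') x k j / y k j by apply: sumr_ge0.
  have s2 : 0 <= \sum_(i | i != k) \sum_j x i j / y i j.
    by apply: sumr_ge0 => i' _; apply: sumr_ge0.
  lra.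
have ay0 := nonneg_scale _ _ a0 y0.
have Tay : lemx (T (a *: y)) (a *: y).
  by move=> k l; rewrite [leRHS]mxE -{2}Ty; apply/ltW/T_scale.
have [l [ayl _ lp Tl]] := descending_orbit _ ay0 Tay.
have ly : l = y by apply: fixed_unique => // k l'; apply/ltW.
rewrite ly in ayl.
apply: squeeze_cvgr (ascending_orbit _ y0 Ty i j) (ayl i j).
apply: nearW => k; apply/andP; split; apply: iter_lemx => // i' j'; rewrite mxE //.
Qed.
End Yates.

(** * The Hermitian inner product on complex column vectors *)

Section Inner.
Context {R : realType} {n : nat}.
Implicit Types (x y f : 'cV[R[i]]_n) (A : 'M[R[i]]_n) (z : R[i]).

Lemma normc_sqr z : (Normc.normc z ^+ 2)%:C = z^* * z.
Proof. by rewrite rmorphXn /= mulrC -normCK; case: z. Qed.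

Lemma innerE x y : inner x y = \sum_k (x k 0)^* * y k 0.
Proof. by rewrite /inner mxE; apply: eq_bigr => k _; rewrite !mxE. Qed.

Lemma inner_conj x y : inner y x = (inner x y)^*.
Proof.
rewrite !innerE rmorph_sum; apply: eq_bigr => k _.
by rewrite rmorphM /= conjCK mulrC.
Qed.

Lemma innerBl x y f : inner (x - y) f = inner x f - inner y f.
Proof.
by rewrite !innerE -sumrB; apply: eq_bigr => k _; rewrite !mxE rmorphB mulrBl.
Qed.

Lemma innerBr x y f : inner f (x - y) = inner f x - inner f y.
Proof. by rewrite /inner mulmxBr !mxE. Qed.

Lemma innerZl z x y : inner (z *: x) y = z^* * inner x y.
Proof.
by rewrite !innerE mulr_sumr; apply: eq_bigr => k _; rewrite !mxE rmorphM mulrA.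
Qed.

Lemma innerZr z x y : inner x (z *: y) = z * inner x y.
Proof. by rewrite /inner -scalemxAr mxE. Qed.

Lemma inner_mulmx A x y : inner x (A *m y) = inner (A ^t* *m x) y.
Proof. by rewrite /inner trmx_mul map_mxM map_trmx trmxK map_mxCK mulmxA. Qed.

Lemma inner_id x : inner x x = (sqnorm x)%:C.
Proof.
by rewrite innerE rmorph_sum; apply: eq_bigr => k _ /=; rewrite normc_sqr.
Qed.

Lemma sqnorm_ge0 x : 0 <= sqnorm x.
Proof. by apply: sumr_ge0 => k _; apply: sqr_ge0. Qed.

Lemma sqnorm_gt0 x : x != 0 -> 0 < sqnorm x.
Proof.
move=> x0; rewrite lt0r sqnorm_ge0 andbT; apply: contra_neq x0 => /eqP.
rewrite psumr_eq0 => [/allP x0|k _]; last exact: sqr_ge0.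
apply/colP => k; rewrite mxE; apply: Normc.eq0_normc; apply/eqP.
by rewrite -sqrf_eq0; apply: (x0 k); rewrite mem_index_enum.
Qed.

Lemma innerDr x y f : inner f (x + y) = inner f x + inner f y.
Proof. by rewrite /inner mulmxDr !mxE. Qed.

Lemma inner_sumr I (r : seq I) (F : I -> 'cV[R[i]]_n) f :
  inner f (\sum_(k <- r) F k) = \sum_(k <- r) inner f (F k).
Proof. by rewrite /inner mulmx_sumr summxE. Qed.

Lemma inner_rank_one x f :
  inner f ((x *m x ^t*) *m f) = (Normc.normc (inner f x) ^+ 2)%:C.
Proof.
rewrite normc_sqr -inner_conj mulrC /inner.
by rewrite -[x *m _ *m f]mulmxA (mulmxA _ x) [LHS]mxE big_ord1.
Qed.

Lemma diag_partE A i j : diag_part A i j = A i i *+ (i == j).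
Proof. by rewrite !mxE. Qed.

Lemma inner_diag_part A f :
  inner f (diag_part A *m f) = \sum_k A k k * (Normc.normc (f k 0) ^+ 2)%:C.
Proof.
rewrite innerE; apply: eq_bigr => k _.
by rewrite mul_diag_mx !mxE normc_sqr mulrCA.
Qed.

End Inner.

(** * Cauchy-Schwarz inequality for a positive definite Hermitian matrix *)

Section PositiveDefinite.
Context {R : realType} {n : nat} (K : 'M[R[i]]_n) (Q : 'cV[R[i]]_n -> R).
Hypothesis K_herm : K ^t* = K.
Hypothesis QE : forall x, inner x (K *m x) = (Q x)%:C.
Hypothesis Q_gt0 : forall x, x != 0 -> 0 < Q x.

(** A row vector [v] with [v K = 0] makes the form vanish at [v ^t*], which definiteness excludes
    unless [v = 0]. *)
Lemma posdef_unitmx : K \in unitmx.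
Proof.
rewrite -row_free_unit; apply/inj_row_free => v vK.
apply/eqP/negPn/negP => v0.
have /Q_gt0 : v ^t* != 0 by rewrite map_mx_eq0 trmx_eq0.
apply/negP; rewrite -leNgt -lecR -QE.
by rewrite -{1}K_herm -map_mxM -trmx_mul vK trmx0 map_mx0 /inner mulmx0 mxE.
Qed.

Variable b : 'cV[R[i]]_n.
Hypothesis b_neq0 : b != 0.
Let y := invmx K *m b.

Lemma posdef_solE : K *m y = b.
Proof. by rewrite /y mulmxA mulmxV ?mul1mx ?posdef_unitmx. Qed.

Lemma posdef_sol_neq0 : y != 0.
Proof. by apply: contra_neq b_neq0 => y0; rewrite -posdef_solE y0 mulmx0. Qed.

Lemma inner_sol : inner y b = (Q y)%:C.
Proof. by rewrite -QE posdef_solE. Qed.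

Lemma herm_form_inv : herm_form (invmx K) b = Q y.
Proof. by rewrite /herm_form -/y inner_conj inner_sol. Qed.

Lemma posdef_CauchySchwarz f : Normc.normc (inner f b) ^+ 2 <= Q f * Q y.
Proof.
have Qy0 : 0 < Q y by apply: Q_gt0 posdef_sol_neq0.
(* [w *: y] is the projection of [f] onto [y] for the inner product of [K]; nonnegativity of [Q] at
   the residual is the inequality. *)
pose g := inner f b; pose w := g^* / (Q y)%:C.
have Qy_real : (Q y)%:C^* = (Q y)%:C by rewrite conj_Creal // ger0_real // ler0c ltW.
have QyC0 : (Q y)%:C != 0 by rewrite fmorph_eq0 gt_eqF.
have w_conj : w^* = g / (Q y)%:C by rewrite rmorphM fmorphV /= conjCK Qy_real.
have QfwE : Q (f - w *: y) = Q f - Normc.normc g ^+ 2 / Q y.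
  apply: complexI; rewrite -QE mulmxBr -scalemxAr posdef_solE.
  rewrite innerBl !innerBr !innerZl !innerZr QE inner_sol w_conj -/g.
  have -> : inner y (K *m f) = g^*.
    by rewrite inner_mulmx K_herm posdef_solE inner_conj.
  rewrite rmorphB rmorphM fmorphV /= normc_sqr /w.
  by field.
have : 0 <= Q (f - w *: y).
  have [->|] := eqVneq (f - w *: y) 0; last by move=> /Q_gt0/ltW.
  by rewrite -lecR -QE /inner mulmx0 mulmx0 mxE.
by rewrite QfwE subr_ge0 ler_pdivrMr.
Qed.
End PositiveDefinite.

(** * The uplink SINR through the quadratic form of [K_i] *)

Section UplinkSINR.
Context {R : realType} {Nc Nu Nb : nat}.
Variables (alpha : R) (gamma : 'I_Nc -> 'I_Nu -> R).
Variable h : 'I_Nc -> 'I_Nc -> 'I_Nu -> 'cV[R[i]]_Nb.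
Hypothesis alpha01 : 0 < alpha <= 1.
Hypothesis gamma_gt0 : forall i u, 0 < gamma i u.
Implicit Types (lam : 'M[R]_(Nc, Nu)) (f : 'cV[R[i]]_Nb) (p : 'I_Nc * 'I_Nu).

Definition gain i p f : R := Normc.normc (inner f (h i p.1 p.2)) ^+ 2.

(** Contribution of user [p] at unit power to [f^H diag(H_i Lambda H_i^H) f]. *)
Definition diag_gain i p f : R :=
  \sum_k Normc.normc (f k 0) ^+ 2 * Normc.normc (h i p.1 p.2 k 0) ^+ 2.

Definition K_form lam i f : R :=
  sqnorm f + \sum_p lam p.1 p.2 *
    (alpha * gain i p f + (1 - alpha) * diag_gain i p f).

Lemma K_formE lam i f : K_form lam i f = sqnorm f
  + alpha * (\sum_p lam p.1 p.2 * gain i p f)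
  + (1 - alpha) * (\sum_p lam p.1 p.2 * diag_gain i p f).
Proof.
rewrite /K_form !mulr_sumr -addrA -big_split; congr (_ + _).
by apply: eq_bigr => p _ /=; ring.
Qed.

Lemma gain_ge0 i p f : 0 <= gain i p f.
Proof. exact: sqr_ge0. Qed.

Lemma diag_gain_ge0 i p f : 0 <= diag_gain i p f.
Proof. by apply: sumr_ge0 => k _; rewrite mulr_ge0 ?sqr_ge0. Qed.

Lemma coupling_ge0 i p f :
  0 <= alpha * gain i p f + (1 - alpha) * diag_gain i p f.
Proof.
have /andP[a0 a1] := alpha01.
by apply: addr_ge0; apply: mulr_ge0;
  rewrite ?gain_ge0 ?diag_gain_ge0 ?subr_ge0 // ltW.
Qed.

Lemma K_form_gt0 lam i f : nonneg_power lam -> f != 0 -> 0 < K_form lam i f.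
Proof.
move=> lam0 f0; rewrite ltr_wpDr ?sqnorm_gt0 //.
by apply: sumr_ge0 => p _; rewrite mulr_ge0 ?coupling_ge0.
Qed.

Lemma K_form_mono lam mu i f : lemx lam mu -> K_form lam i f <= K_form mu i f.
Proof.
move=> le_lm; rewrite lerD2l; apply: ler_sum => p _.
by rewrite ler_wpM2r ?coupling_ge0.
Qed.

(** The inequality is strict because the noise term [sqnorm f > 0] is multiplied by [a] only on the
    right. *)
Lemma K_form_scale a lam i f : 1 < a -> f != 0 ->
  K_form (a *: lam) i f < a * K_form lam i f.
Proof.
move=> a1 f0; rewrite [ltRHS]mulrDr ltr_leD //.
  by rewrite ltr_pMl ?sqnorm_gt0.
by rewrite mulr_sumr; apply: ler_sum => p _; rewrite mxE -mulrA.
Qed.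

Lemma rx_cov_diag lam i k : rx_cov h lam i k k =
  (\sum_p lam p.1 p.2 * Normc.normc (h i p.1 p.2 k 0) ^+ 2)%:C.
Proof.
rewrite mxE rmorph_sum /=.
rewrite (reindex _ (curry_mxvec_bij _ _)) /=.
apply: eq_bigr => -[j v] _ /=.
rewrite mul_mx_diag !mxE !mxvecE !mxE rmorphM /= normc_sqr.
by ring.
Qed.

Lemma inner_diag_rx_cov lam i f : inner f (diag_part (rx_cov h lam i) *m f) =
  (\sum_p lam p.1 p.2 * diag_gain i p f)%:C.
Proof.
rewrite inner_diag_part.
under eq_bigr => k _ do rewrite rx_cov_diag -rmorphM /= mulr_suml.
rewrite -rmorph_sum /= exchange_big /=; congr (_%:C).
apply: eq_bigr => p _; rewrite mulr_sumr; apply: eq_bigr => k _.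
by ring.
Qed.

Lemma inner_K_mx lam i f :
  inner f (K_mx alpha h lam i *m f) = (K_form lam i f)%:C.
Proof.
rewrite K_formE !mulmxDl !innerDr mul1mx inner_id -!scalemxAl !innerZr.
rewrite inner_diag_rx_cov !rmorphD !rmorphM /=; congr (_ + _ * _ + _); last by rewrite -rmorphD.
rewrite pair_bigA mulmx_suml inner_sumr rmorph_sum; apply: eq_bigr => p _ /=.
by rewrite -scalemxAl innerZr inner_rank_one -rmorphM.
Qed.

Lemma K_mx_herm lam i : (K_mx alpha h lam i) ^t* = K_mx alpha h lam i.
Proof.
have conj_real (r : R) : (r%:C)^* = r%:C by rewrite conj_Creal // complex_real.
have conjZ (r : R) (z : R[i]) : (r%:C * z)^* = r%:C * z^*.
  by rewrite rmorphM /= conj_real.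
rewrite /K_mx; set D := diag_part _.
have D_conj a b : (D b a)^* = D a b.
  rewrite /D !diag_partE eq_sym; have [->|_] := eqVneq; last by rewrite conjC0.
  by rewrite !mulr1n rx_cov_diag conj_real.
move: D D_conj => D D_conj.
apply/matrixP => a b; rewrite !mxE !(rmorphD Num.conj) /= !conjZ D_conj.
congr (_ + _ * _ + _); first by rewrite eq_sym conjC_nat.
rewrite !summxE rmorph_sum; apply: eq_bigr => j _ /=.
rewrite !summxE rmorph_sum; apply: eq_bigr => v _ /=.
rewrite !mxE conjZ !big_ord1 !mxE rmorphM /= conjCK.
by rewrite [X in _ * X]mulrC.
Qed.

Lemma herm_form_quant_cov lam i f : herm_form (quant_cov alpha h lam i) f =
  alpha * (1 - alpha) * (\sum_p lam p.1 p.2 * diag_gain i p f + sqnorm f).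
Proof.
rewrite /herm_form /quant_cov.
have -> : diag_part (rx_cov h lam i + 1%:M) = diag_part (rx_cov h lam i) + 1%:M.
  apply/matrixP => a b; rewrite !mxE eqxx.
  by rewrite mulrnDl.
by rewrite -scalemxAl innerZr mulmxDl mul1mx innerDr inner_diag_rx_cov inner_id
  -rmorphD -rmorphM.
Qed.

Lemma K_form_gt_gain lam i u f : nonneg_power lam -> f != 0 ->
  alpha * lam i u * gain i (i, u) f < K_form lam i f.
Proof.
move=> lam0 f0; have /andP[a0 a1] := alpha01.
rewrite K_formE (bigD1 (i, u)) //= mulrDr -mulrA.
set S := \sum_(p | _) _; set D := \sum_p _.
have S0 : 0 <= S by apply: sumr_ge0 => p _; rewrite mulr_ge0 ?gain_ge0.
have D0 : 0 <= D.
  by apply: sumr_ge0 => p _; rewrite mulr_ge0 ?diag_gain_ge0.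
have := sqnorm_gt0 _ f0; have := mulr_ge0 (ltW a0) S0.
have : 0 <= (1 - alpha) * D by rewrite mulr_ge0 ?subr_ge0.
lra.
Qed.

(** The two noise terms [alpha * (1 - alpha) * sqnorm f] and [alpha ^+ 2 * sqnorm f] add up to
    [alpha * sqnorm f], so the denominator is [alpha] times [K_form] minus the useful signal. *)
Lemma SINR_ulE lam i u f : nonneg_power lam -> f != 0 ->
  SINR_ul alpha h lam i u f = alpha * lam i u * gain i (i, u) f
    / (K_form lam i f - alpha * lam i u * gain i (i, u) f).
Proof.
move=> lam0 f0; have /andP[a0 a1] := alpha01.
have := K_form_gt_gain lam i u f lam0 f0; rewrite -subr_gt0 => den0.
have -> : SINR_ul alpha h lam i u f =
    alpha ^+ 2 * lam i u * gain i (i, u) f /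
    (alpha * (K_form lam i f - alpha * lam i u * gain i (i, u) f)).
  rewrite /SINR_ul herm_form_quant_cov K_formE; congr (_ / _).
  rewrite [in RHS](bigD1 (i, u)) //= -/(gain i (i, u) f).
  by rewrite /gain /=; ring.
by field; rewrite !gt_eqF.
Qed.

(** * The iteration map at a single user *)

Section Step.
Variables (i : 'I_Nc) (u : 'I_Nu).
Hypothesis h_neq0 : h i i u != 0.

Let c := alpha * (1 + (gamma i u)^-1).

Let c_gt0 : 0 < c.
Proof.
by have /andP[a0 _] := alpha01; rewrite mulr_gt0 // addr_gt0 ?invr_gt0.
Qed.

(* [y] is the MMSE combiner [K^-1 h] and [s = h^H K^-1 h]. They are
   existentially quantified to keep unification from unfolding [invmx].      *)
Lemma mmse_spec lam : nonneg_power lam -> exists y s,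
  [/\ y != 0, 0 < s, K_form lam i y = s, gain i (i, u) y = s ^+ 2 &
      (forall f, gain i (i, u) f <= K_form lam i f * s) /\
      (c * s)^-1 = power_step alpha gamma h lam i u].
Proof.
move=> lam0; have K_gt0 f : f != 0 -> 0 < K_form lam i f by apply: K_form_gt0.
have Kh := K_mx_herm lam i; have KE := inner_K_mx lam i.
have y0 := posdef_sol_neq0 _ _ Kh KE K_gt0 _ h_neq0.
pose y := invmx (K_mx alpha h lam i) *m h i i u.
exists y, (K_form lam i y); split=> //; first exact: K_gt0.
  rewrite /gain (inner_sol _ _ Kh KE K_gt0) /Normc.normc /= expr0n addr0.
  by rewrite sqr_sqrtr ?sqr_ge0.
split; first exact: posdef_CauchySchwarz Kh KE K_gt0 _ h_neq0.
by rewrite [RHS]mxE !div1r (herm_form_inv _ _ Kh KE K_gt0).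
Qed.

Lemma power_step_gt0 lam : nonneg_power lam ->
  0 < power_step alpha gamma h lam i u.
Proof.
by move=> /mmse_spec[y [s [_ s0 _ _ [_ <-]]]]; rewrite invr_gt0 (mulr_gt0 c_gt0).
Qed.

(** Testing the bound for [lam] at the optimal combiner [y] of [mu] gives
    [t ^+ 2 <= K_form lam i y * s <= t * s], hence [t <= s]. *)
Lemma power_step_mono lam mu : nonneg_power lam -> lemx lam mu ->
  power_step alpha gamma h lam i u <= power_step alpha gamma h mu i u.
Proof.
move=> lam0 le_lm; have mu0 := nonneg_lemx _ _ lam0 le_lm.
have [_ [s [_ s0 _ _ [gain_le Ts]]]] := mmse_spec _ lam0.
have [y [t [_ t0 Ky gain_y [_ Tt]]]] := mmse_spec _ mu0.
suff : (c * s)^-1 <= (c * t)^-1 by rewrite Ts Tt.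
rewrite lef_pV2 ?posrE ?(mulr_gt0 c_gt0) // ler_pM2l // -(ler_pM2l t0) -expr2 -gain_y.
apply: le_trans (gain_le y) _.
by rewrite ler_pM2r // -Ky K_form_mono.
Qed.

(** Testing the bound for [a *: lam] at the optimal combiner [y] of [lam] gives [s ^+ 2 <= K_form (a
    *: lam) i y * t < a * s * t], hence [s < a * t]. *)
Lemma power_step_scale a lam : 1 < a -> nonneg_power lam ->
  power_step alpha gamma h (a *: lam) i u < a * power_step alpha gamma h lam i u.
Proof.
move=> a1 lam0; have a0 : 0 < a by apply: lt_trans a1.
have al0 : nonneg_power (a *: lam) by apply: nonneg_scale; rewrite ?ltW.
have [y [s [y0 s0 Ky gain_y [_ Ts]]]] := mmse_spec _ lam0.
have [_ [t [_ t0 _ _ [gain_le Tt]]]] := mmse_spec _ al0.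
suff : (c * t)^-1 < a * (c * s)^-1 by rewrite Ts Tt.
rewrite -ltr_pdivrMl // -invfM ltf_pV2 ?posrE ?(mulr_gt0 a0) ?(mulr_gt0 c_gt0) //
  mulrCA ltr_pM2l //.
rewrite -(ltr_pM2l s0) -expr2 -gain_y.
apply: le_lt_trans (gain_le y) _.
by rewrite mulrA ltr_pM2r // [s * a]mulrC -Ky K_form_scale.
Qed.

Lemma max_SINR_geP lam : nonneg_power lam ->
  (exists2 m, is_max_SINR_ul alpha h lam i u m & gamma i u <= m) <->
  power_step alpha gamma h lam i u <= lam i u.
Proof.
move=> lam0; have /andP[a0 _] := alpha01; have g0 := gamma_gt0 i u.
have [y [s [y0 s0 Ky gain_y [gain_le <-]]]] := mmse_spec _ lam0.
have SINR_le f : f != 0 ->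
    SINR_ul alpha h lam i u f <= SINR_ul alpha h lam i u y.
  move=> f0; rewrite !SINR_ulE // ler_pdivrMr ?subr_gt0 ?K_form_gt_gain //.
  rewrite [leRHS]mulrAC ler_pdivlMr ?subr_gt0 ?K_form_gt_gain // -subr_ge0 gain_y Ky.
  set t := alpha * lam i u.
  (* The cross-multiplied difference of the two SINRs is a nonnegative multiple of the
     Cauchy-Schwarz gap. *)
  have -> : t * s ^+ 2 * (K_form lam i f - t * gain i (i, u) f)
      - t * gain i (i, u) f * (s - t * s ^+ 2)
      = t * s * (K_form lam i f * s - gain i (i, u) f) by ring.
  by rewrite !mulr_ge0 ?subr_ge0 // ltW.
have <- : (gamma i u <= SINR_ul alpha h lam i u y) = ((c * s)^-1 <= lam i u).
  rewrite -[_^-1]mul1r (ler_pdivrMr _ _ (mulr_gt0 c_gt0 s0)).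
  rewrite SINR_ulE // ler_pdivlMr ?subr_gt0 ?K_form_gt_gain // gain_y Ky.
  (* After multiplying the right side by [gamma i u * s], both differences equal [alpha * lam i u *
     s ^+ 2 * (1 + gamma i u) - gamma i u * s]. *)
  rewrite -subr_ge0 -[RHS]subr_ge0 -[RHS](pmulr_rge0 _ (mulr_gt0 g0 s0)).
  by congr (0 <= _); rewrite /c; field; rewrite gt_eqF.
split=> [[_ [[f f0 <-] _] le_gm]|le_g]; first exact: le_trans (SINR_le f f0).
by exists (SINR_ul alpha h lam i u y) => //; split=> //; exists y.
Qed.

End Step.

(** A zero direct channel forces SINR 0, below the positive target. Nonzero channels are what makes
    the iteration map positive. *)
Lemma feasible_channel_neq0 F lam i u :
  P1_feasible alpha gamma h F lam -> h i i u != 0.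
Proof.
move=> [_ _ /(_ i u)[_ [[g g0 <-] _]]]; apply: contraTneq => hiu.
rewrite -ltNge /SINR_ul hiu.
have -> : inner g 0 = 0 by rewrite /inner mulmx0 mxE.
by rewrite Normc.normc0 expr0n mulr0 mul0r.
Qed.

End UplinkSINR.

(** * Convergence to the fixed point and its optimality *)

Theorem corollary4 (R : realType) (Nc Nu Nb : nat)
    (hNc : (0 < Nc)%N) (hNu : (0 < Nu)%N) (hNb : (0 < Nb)%N)
    (alpha : R) (halpha : 0 < alpha <= 1)
    (gamma : 'I_Nc -> 'I_Nu -> R) (hgamma : forall i u, 0 < gamma i u)
    (h : 'I_Nc -> 'I_Nc -> 'I_Nu -> 'cV[R[i]]_Nb)
    (hfeas : exists f lam, P1_feasible alpha gamma h f lam) :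
  exists lamstar : 'M[R]_(Nc, Nu),
    [/\ nonneg_power lamstar /\ power_step alpha gamma h lamstar = lamstar,
        forall lam : 'M[R]_(Nc, Nu), nonneg_power lam ->
          power_step alpha gamma h lam = lam -> lam = lamstar,
        forall lam0 : 'M[R]_(Nc, Nu), nonneg_power lam0 ->
          forall i u,
            (fun n : nat => iter n (power_step alpha gamma h) lam0 i u)
              @ \oo --> lamstar i u
      & exists f, P1_optimal alpha gamma h f lamstar].
Proof.
have [f0 [lam' feas]] := hfeas.
have hne i u : h i i u != 0 by apply: feasible_channel_neq0 feas.
pose T := power_step alpha gamma h.
have T_gt0 lam : nonneg_power lam -> forall i u, 0 < T lam i u.
  by move=> lam0 i u; apply: power_step_gt0.
have T_mono lam mu : nonneg_power lam -> lemx lam mu -> lemx (T lam) (T mu).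
  by move=> lam0 le_lm i u; apply: power_step_mono.
have T_scale a lam : 1 < a -> nonneg_power lam ->
    forall i u, T (a *: lam) i u < a * T lam i u.
  by move=> a1 lam0 i u; apply: power_step_scale.
have feas_step f lam : P1_feasible alpha gamma h f lam ->
    nonneg_power lam /\ lemx (T lam) lam.
  by move=> [_ lam0 ge_g]; split=> // i u; apply/max_SINR_geP.
have [lam'0 Tlam'] := feas_step _ _ feas.
(* Existence of the fixed point: the orbit of the given feasible allocation decreases to it. *)
have [l [_ _ l0 Tl]] := descending_orbit T T_gt0 T_mono T_scale _ lam'0 Tlam'.
have lp : nonneg_power l by move=> i u; apply/ltW.
have Tl_le : lemx (T l) l by move=> i u; rewrite Tl.
exists l; split => //.
- by move=> lam lam0 Tlam; apply: (fixed_unique T).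
- by move=> lam0 lam00 i u; apply: (cvg_iter_fixed T).
(* Feasibility asks of the combiners only that they be nonzero, so those of the given feasible point
   serve. *)
exists f0; split.
  have [f0_neq0 _ _] := feas; split=> // i u.
  by apply/(max_SINR_geP _ _ _ halpha hgamma _ _ (hne i u) _ lp)/Tl_le.
move=> f mu /feas_step[mu0 Tmu].
(* The orbit of any feasible [mu] descends to a fixed point below [mu], which is [l] by uniqueness;
   so [l <= mu] entrywise. *)
have [l' [_ l'mu l'0 Tl']] := descending_orbit T T_gt0 T_mono T_scale _ mu0 Tmu.
have l'p : nonneg_power l' by move=> i u; apply/ltW.
rewrite (fixed_unique T T_gt0 T_mono T_scale _ _ lp l'p Tl Tl').
by apply: ler_sum => i _; apply: ler_sum => u _; apply: l'mu.
Qed.
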